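(* Let $X$ be the universal covering group of $SL_2(\mathbb{R})$, and let $x\in X$ be such that $\langle x\rangle=Z(X)$ (where $Z(X)\cong\mathbb{Z}$). Let $Y$ be the (additive, compact) group of $2$-adic integers, and let $y\in Y$ be such that $\overline{\langle y\rangle}=Y$. Let $u:\langle x\rangle\to\langle y\rangle$ be the homomorphism given by $u(x)=y$, let $\Gamma(u)=\{(z,u(z)):z\in\langle x\rangle\}\subseteq X\times Y$ be its graph, and let $G=(X\times Y)/\Gamma(u)$. Then $G$ is a connected locally compact group that does not admit normal subgroups $K,L$ such that $L$ is a virtual Lie group, $K$ is a compact connected group and $G=KL$.
   Context: A topological group is a group with a Hausdorff topology such that multiplication and inversion are continuous. A Lie group is a topological group whose topology is that of a (finite-dimensional) smooth manifold for which multiplication and inversion are smooth. A topological group is a virtual Lie group if its underlying group admits a topology, stronger than (i.e. containing, possibly equal to) the given one, which makes it a connected Lie group. Subgroups of $G$ carry the subspace topology, $G$ carries the quotient topology, and $\langle g\rangle$ denotes the subgroup generated by $g$. *)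

(* Defs.v *)
From HB Require Import structures.
From mathcomp Require Import all_boot all_order all_algebra.
From mathcomp Require Import generic_quotient.
From mathcomp Require Import all_classical all_reals all_analysis.
Import numFieldNormedType.Exports.

Set Implicit Arguments.
Unset Strict Implicit.
Unset Printing Implicit Defensive.

Import Order.TTheory GRing.Theory Num.Theory.

Local Open Scope classical_set_scope.
Local Open Scope ring_scope.
Local Open Scope group_scope.
Local Open Scope quotient_scope.

#[short(type="preTopologicalGroupType")]
HB.structure Definition PreTopologicalGroup := {G of Group G & Topological G}.

HB.instance Definition _ (G H : preTopologicalGroupType) :=
  Group.on (G * H)%type.

Definition topological_group (G : preTopologicalGroupType) : Prop :=
  [/\ hausdorff_space G,
      continuous (fun z : G * G => z.1 * z.2) &
      continuous (fun x : G => x^-1)].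

Definition group_center (G : groupType) : set G :=
  [set z | forall g, z * g = g * z].
Arguments group_center : clear implicits.

Record subgroup (G : groupType) := Subgroup {
  subgroup_set :> set G;
  subgroupP : group_closed (mem subgroup_set) }.

Definition normal_subgroup (G : groupType) (H : subgroup G) : Prop :=
  forall g h, h \in (H : set G) -> h ^ g \in (H : set G).

Definition subg (G : groupType) (H : subgroup G) : Type :=
  set_type (subgroup_set H).

Section SubgroupType.
Variables (G : groupType) (H : subgroup G).

HB.instance Definition _ := SubChoice.copy (subg H) (set_type (subgroup_set H)).
HB.instance Definition _ :=
  SubChoice_isSubGroup.Build G _ (subg H) (subgroupP H).

End SubgroupType.

HB.instance Definition _ (G : preTopologicalGroupType) (H : subgroup G) :=
  Topological.copy (subg H) (initial_topology (val : subg H -> G)).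

Section CyclicSubgroup.
Variables (G : groupType) (x : G).

Definition cyclic_set : set G :=
  [set z | exists n : nat, z = x ^+ n \/ z = x ^- n].

Let cyclic_divX m n : cyclic_set (x ^+ m / x ^+ n).
Proof.
have [le_nm|/ltnW le_mn] := leqP n m.
  by exists (m - n)%N; left; rewrite -{1}(subnK le_nm) expgnDr mulgK.
exists (n - m)%N; right.
by rewrite -{1}(subnK le_mn) expgnDr invgM mulVKg.
Qed.

Let commXV m n : x ^- m * x ^+ n = x ^+ n * x ^- m.
Proof. exact/commute_sym/commuteV/commuteX2/commute_refl. Qed.

Fact cyclic_closed : group_closed (mem cyclic_set).
Proof.
split=> [|a b]; first by rewrite inE; exists 0%N; left.
rewrite !inE => -[m [->|->]] [n [->|->]] /=.
- exact: cyclic_divX.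
- by exists (m + n)%N; left; rewrite invgK expgnDr.
- by exists (n + m)%N; right; rewrite expgnDr invgM.
- by rewrite invgK commXV; exact: cyclic_divX.
Qed.

Definition cyclic_subgroup : subgroup G := Subgroup cyclic_closed.

Fact cyclic_id : x \in (cyclic_subgroup : set G).
Proof. by rewrite inE; exists 1%N; left. Qed.

Definition cyclic_gen : subg cyclic_subgroup := Sub x cyclic_id.
End CyclicSubgroup.

Section Graph.
Variables (G1 G2 : groupType) (H1 : subgroup G1) (H2 : subgroup G2).
Variable u : {multiplicative subg H1 -> subg H2}.

Definition graph_set : set (G1 * G2) :=
  [set w | exists z : subg H1, w = (val z, val (u z))].

Fact graph_closed : group_closed (mem graph_set).
Proof.
have u1 : u 1 = 1.
  by apply: (mulgI (u 1)); rewrite mulg1 -gmulfM mulg1.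
have uV z : u z^-1 = (u z)^-1.
  by apply: (mulgI (u z)); rewrite -gmulfM !mulgV u1.
split=> [|a b]; rewrite !inE.
  by exists 1; rewrite u1 !val1.
by move=> [c ->] [d ->]; exists (c / d); rewrite [u (_ * _)]gmulfM uV !valM.
Qed.

Definition graph_subgroup : subgroup (G1 * G2)%type := Subgroup graph_closed.

Lemma graph_normal :
  (H1 : set G1) `<=` group_center G1 -> (H2 : set G2) `<=` group_center G2 ->
  normal_subgroup graph_subgroup.
Proof.
move=> c1 c2 [g1 g2] _ /set_mem[z ->]; rewrite inE; exists z.
have /set_mem/c1 e1 := valP z; have /set_mem/c2 e2 := valP (u z).
by rewrite conjgE; congr (_, _) => /=; rewrite ?e1 ?e2 mulKg.
Qed.
End Graph.
Arguments graph_normal {G1 G2 H1 H2} u _ _.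

Section QuotientGroup.
Variables (G : preTopologicalGroupType) (N : subgroup G) (nN : normal_subgroup N).

Definition lcoset_rel (a b : G) : bool := a^-1 * b \in (N : set G).

Let NV a : a \in (N : set G) -> a^-1 \in (N : set G).
Proof. exact: (group_closedV (subgroupP N)). Qed.
Let NM a b :
  a \in (N : set G) -> b \in (N : set G) -> a * b \in (N : set G).
Proof. exact: (group_closedM (subgroupP N)). Qed.

Fact lcoset_refl : reflexive lcoset_rel.
Proof. by move=> a; rewrite /lcoset_rel mulVg; exact: (subgroupP N).1. Qed.
Fact lcoset_sym : symmetric lcoset_rel.
Proof.
by move=> a b; apply/idP/idP => /NV; rewrite /lcoset_rel invgM invgK.
Qed.
Fact lcoset_trans : transitive lcoset_rel.
Proof.
by move=> b a c ab bc; have := NM ab bc; rewrite /lcoset_rel mulgA mulgK.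
Qed.

Definition lcoset_equiv : equiv_rel G :=
  EquivRel lcoset_rel lcoset_refl lcoset_sym lcoset_trans.

(* The normality proof nN is an argument because the group law below needs it *)
Definition quotient_group of normal_subgroup N : Type :=
  quotient_topology {eq_quot lcoset_equiv}.
Notation Q := (quotient_group nN).

HB.instance Definition _ :=
  Quotient.copy Q (quotient_topology {eq_quot lcoset_equiv}).
HB.instance Definition _ :=
  Topological.copy Q (quotient_topology {eq_quot lcoset_equiv}).



Lemma quotient_eqP (a b : G) :
  \pi_Q a = \pi_Q b <-> a^-1 * b \in (N : set G).
Proof.
by split=> /(@eqmodP _ lcoset_equiv).
Qed.

Definition quotient_one : Q := \pi_Q 1.
Definition quotient_mul (a b : Q) : Q := \pi_Q (repr a * repr b).
Definition quotient_inv (a : Q) : Q := \pi_Q (repr a)^-1.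

Lemma quotient_mulE (a b : G) :
  quotient_mul (\pi_Q a) (\pi_Q b) = \pi_Q (a * b).
Proof.
have /quotient_eqP Ha : \pi_Q (repr (\pi_Q a)) = \pi_Q a by rewrite reprK.
have /quotient_eqP Hb : \pi_Q (repr (\pi_Q b)) = \pi_Q b by rewrite reprK.
apply/quotient_eqP; move: (repr (\pi_Q a)) (repr (\pi_Q b)) Ha Hb => a' b' Ha Hb.
have := NM (nN b' Ha) Hb.
by rewrite conjgE invgM -!mulgA mulVKg.
Qed.

Lemma quotient_invE (a : G) : quotient_inv (\pi_Q a) = \pi_Q a^-1.
Proof.
have /quotient_eqP Ha : \pi_Q (repr (\pi_Q a)) = \pi_Q a by rewrite reprK.
apply/quotient_eqP; move: (repr _) Ha => a' /NV Ha.
have := nN a'^-1 Ha.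
by rewrite conjgE invgM !invgK -!mulgA mulgV mulg1.
Qed.

Fact quotient_mulA : associative quotient_mul.
Proof.
elim/quotW=> a; elim/quotW=> b; elim/quotW=> c.
by rewrite (quotient_mulE b) (quotient_mulE a b) !quotient_mulE mulgA.
Qed.
Fact quotient_mul1g : left_id quotient_one quotient_mul.
Proof. by elim/quotW=> a; rewrite quotient_mulE mul1g. Qed.
Fact quotient_mulg1 : right_id quotient_one quotient_mul.
Proof. by elim/quotW=> a; rewrite quotient_mulE mulg1. Qed.
Fact quotient_mulVg : left_inverse quotient_one quotient_inv quotient_mul.
Proof.
by elim/quotW=> a; rewrite quotient_invE quotient_mulE mulVg.
Qed.
Fact quotient_mulgV : right_inverse quotient_one quotient_inv quotient_mul.
Proof.
by elim/quotW=> a; rewrite quotient_invE quotient_mulE mulgV.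
Qed.

HB.instance Definition _ := isGroup.Build Q
  quotient_mulA quotient_mul1g quotient_mulg1 quotient_mulVg quotient_mulgV.
End QuotientGroup.

Section Smoothness.
Variable R : realType.

(* Class C^k on U through iterated partial derivatives; U is meant to be open,
   and the values of f outside U are irrelevant *)
Fixpoint class_C (k n m : nat) (U : set 'rV[R]_n) (f : 'rV[R]_n -> 'rV[R]_m)
    : Prop :=
  (forall x, U x -> {for x, continuous f}) /\
  if k is k'.+1 then
    forall i : 'I_n,
      (forall x, U x -> derivable f x (delta_mx ord0 i)) /\
      class_C k' U (fun x => 'D_(delta_mx ord0 i) f x)
  else True.

Definition smooth_on n m (U : set 'rV[R]_n) (f : 'rV[R]_n -> 'rV[R]_m) : Prop :=
  forall k, class_C k U f.

End Smoothness.

(* f restricts to a homeomorphism from U onto V, with inverse g *)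
Definition homeomorphism_on (S T : topologicalType) (U : set S) (V : set T)
    (f : S -> T) (g : T -> S) : Prop :=
  [/\ set_fun U V f, set_fun V U g,
      (forall s, U s -> g (f s) = s) /\ (forall t, V t -> f (g t) = t),
      {within U, continuous f} & {within V, continuous g}].

Section Manifold.
Variable R : realType.

(* Both maps are total; only their restrictions to chart_dom and chart_cod
   matter *)
Record chart (T : Type) (n : nat) := Chart {
  chart_dom : set T;
  chart_cod : set 'rV[R]_n;
  chart_to : T -> 'rV[R]_n;
  chart_from : 'rV[R]_n -> T }.

Definition is_chart (T : topologicalType) n (c : chart T n) : Prop :=
  [/\ open (chart_dom c), open (chart_cod c) &
      homeomorphism_on (chart_dom c) (chart_cod c) (chart_to c) (chart_from c)].

Definition smooth_atlas (T : topologicalType) n (A : set (chart T n)) : Prop :=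
  [/\ forall c, A c -> is_chart c,
      forall t, exists2 c, A c & chart_dom c t &
      forall c d, A c -> A d ->
        smooth_on (chart_cod c `&` chart_from c @^-1` chart_dom d)
                  (chart_to d \o chart_from c)].

Definition smooth_map (S T : topologicalType) m n (A : set (chart S m))
    (B : set (chart T n)) (f : S -> T) : Prop :=
  continuous f /\
  forall c d, A c -> B d ->
    smooth_on (chart_cod c `&` (f \o chart_from c) @^-1` chart_dom d)
              (chart_to d \o f \o chart_from c).

Definition prod_chart (S T : Type) m n (c : chart S m) (d : chart T n) :
    chart (S * T)%type (m + n) :=
  Chart (chart_dom c `*` chart_dom d)
        [set w : 'rV[R]_(m + n) |
           chart_cod c (lsubmx w) /\ chart_cod d (rsubmx w)]
        (fun z => row_mx (chart_to c z.1) (chart_to d z.2))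
        (fun w => (chart_from c (lsubmx w), chart_from d (rsubmx w))).

Definition prod_atlas (S T : Type) m n (A : set (chart S m))
    (B : set (chart T n)) : set (chart (S * T)%type (m + n)) :=
  [set e | exists c d, [/\ A c, B d & e = prod_chart c d]].

(* Second countability is part of the notion of manifold; for a connected group
   it follows from the other conditions *)
Definition lie_group (G : preTopologicalGroupType) : Prop :=
  [/\ topological_group G, second_countable (T := G) &
      exists n (A : set (chart G n)),
        [/\ smooth_atlas A,
            smooth_map (prod_atlas A A) A (fun z : G * G => z.1 * z.2) &
            smooth_map A A (fun x : G => x^-1)]].

End Manifold.

Record topology_on (T : Type) := TopologyOn {
  is_open : set_system T;
  is_openT : is_open setT;
  is_openI : setI_closed is_open;
  is_open_bigU : forall (I : Type) (f : I -> set T),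
    (forall i, is_open (f i)) -> is_open (\bigcup_i f i) }.

Definition retopologize (G : groupType) (tau : topology_on G) : Type := G.

Section Retopologize.
Variables (G : groupType) (tau : topology_on G).
HB.instance Definition _ := Group.copy (retopologize tau) G.
HB.instance Definition _ := isOpenTopological.Build (retopologize tau)
  (is_openT tau) (@is_openI _ tau) (@is_open_bigU _ tau).

Lemma open_retopologize (U : set (retopologize tau)) : open U = is_open tau U.
Proof. by []. Qed.
End Retopologize.

Definition virtual_lie_group (R : realType) (G : preTopologicalGroupType)
    : Prop :=
  topological_group G /\
  exists tau : topology_on G,
    [/\ forall U : set G, open U -> is_open tau U,
        lie_group R (retopologize tau) &
        connected [set: retopologize tau]].

Definition covering_map (E B : topologicalType) (p : E -> B) : Prop :=
  [/\ continuous p, set_surj setT setT p &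
      forall b, exists V : set B, [/\ open V, V b &
        exists (I : Type) (U : I -> set E) (s : I -> B -> E),
          [/\ p @^-1` V = \bigcup_i U i, trivIset setT U &
              forall i, open (U i) /\ homeomorphism_on (U i) V p (s i)]]].

Section SimplyConnected.
Variables (R : realType) (T : topologicalType).

Definition path_between (a b : T) (f : R -> T) : Prop :=
  [/\ {within `[0%R, 1%R], continuous f}, f 0%R = a & f 1%R = b].

Definition null_homotopic (f : R -> T) : Prop :=
  exists H : R * R -> T,
    [/\ {within `[0%R, 1%R] `*` `[0%R, 1%R], continuous H},
        forall t, t \in `[0%R, 1%R] -> H (t, 0%R) = f t,
        forall t, t \in `[0%R, 1%R] -> H (t, 1%R) = f 0%R &
        forall s, s \in `[0%R, 1%R] -> H (0%R, s) = f 0%R /\ H (1%R, s) = f 0%R].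

Definition simply_connected : Prop :=
  (forall a b : T, exists f, path_between a b f) /\
  (forall (a : T) f, path_between a a f -> null_homotopic f).

End SimplyConnected.

Definition universal_covering_group (R : realType)
    (X B : preTopologicalGroupType) (p : {multiplicative X -> B}) : Prop :=
  [/\ topological_group X, simply_connected R X & covering_map p].

Definition SL (R : comUnitRingType) (n : nat) : Type :=
  {A : 'M[R]_n | (\det A == 1)%R}.

Section SpecialLinear.
Variables (R : comUnitRingType) (n : nat).
Notation S := (SL R n).

HB.instance Definition _ :=
  SubChoice.copy S {A : 'M[R]_n | (\det A == 1)%R}.

Fact SL_one_subproof : (\det (1%:M : 'M[R]_n) == 1)%R.
Proof. by rewrite det1. Qed.
Fact SL_mul_subproof (A B : S) : (\det (val A *m val B) == 1)%R.
Proof. by rewrite det_mulmx (eqP (valP A)) (eqP (valP B)) mulr1. Qed.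
Fact SL_inv_subproof (A : S) : (\det (invmx (val A)) == 1)%R.
Proof. by rewrite det_inv (eqP (valP A)) invr1. Qed.

Definition SL_one : S := Sub 1%:M%R SL_one_subproof.
Definition SL_mul (A B : S) : S := Sub (val A *m val B)%R (SL_mul_subproof A B).
Definition SL_inv (A : S) : S := Sub (invmx (val A)) (SL_inv_subproof A).

Fact SL_unit (A : S) : val A \in unitmx.
Proof. by rewrite unitmxE (eqP (valP A)) unitr1. Qed.

Fact SL_mulA : associative SL_mul.
Proof. by move=> A B C; apply: val_inj; exact: mulmxA. Qed.
Fact SL_mul1g : left_id SL_one SL_mul.
Proof. by move=> A; apply: val_inj; exact: mul1mx. Qed.
Fact SL_mulg1 : right_id SL_one SL_mul.
Proof. by move=> A; apply: val_inj; exact: mulmx1. Qed.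
Fact SL_mulVg : left_inverse SL_one SL_inv SL_mul.
Proof. by move=> A; apply: val_inj; exact: mulVmx (SL_unit A). Qed.
Fact SL_mulgV : right_inverse SL_one SL_inv SL_mul.
Proof. by move=> A; apply: val_inj; exact: mulmxV (SL_unit A). Qed.

HB.instance Definition _ := isGroup.Build S
  SL_mulA SL_mul1g SL_mulg1 SL_mulVg SL_mulgV.
End SpecialLinear.

HB.instance Definition _ (R : realType) (n : nat) :=
  Topological.copy (SL R n) (initial_topology (val : SL R n -> 'M[R]_n)).

(* The inverse limit of the rings Z/2^n: residue a n is the representative in
   [0, 2^n) of the class of a modulo 2^n *)
Record Z2adic := Z2Adic {
  residue : nat -> nat;
  residue_compat : forall n, residue n = (residue n.+1 %% 2 ^ n)%N }.

HB.instance Definition _ := gen_eqMixin Z2adic.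
HB.instance Definition _ := gen_choiceMixin Z2adic.

(* The group law is addition; it is only written multiplicatively *)
Section Z2adicGroup.
Implicit Types a b c : Z2adic.

Lemma residue_inj a b : residue a =1 residue b -> a = b.
Proof.
case: a b => [f fP] [g gP] /= /funext E.
by case: _ / E gP => gP; rewrite (Prop_irrelevance fP gP).
Qed.

Let modn_mod2 m n : (m %% 2 ^ n.+1 %% 2 ^ n = m %% 2 ^ n)%N.
Proof. by rewrite modn_dvdm // expnS dvdn_mull. Qed.

Lemma residue_mod a n : (residue a n %% 2 ^ n)%N = residue a n.
Proof. by rewrite residue_compat modn_mod. Qed.

Let zero_compat n : 0%N = (0 %% 2 ^ n)%N.
Proof. by rewrite mod0n. Qed.
Definition Z2adic_zero := @Z2Adic (fun=> 0%N) zero_compat.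

Let add_compat a b n :
  ((residue a n + residue b n) %% 2 ^ n =
   ((residue a n.+1 + residue b n.+1) %% 2 ^ n.+1) %% 2 ^ n)%N.
Proof.
by rewrite modn_mod2 (residue_compat a n) (residue_compat b n) modnDm.
Qed.
Definition Z2adic_add a b := Z2Adic (add_compat a b).

Let opp_compat a n :
  ((2 ^ n - residue a n) %% 2 ^ n =
   ((2 ^ n.+1 - residue a n.+1) %% 2 ^ n.+1) %% 2 ^ n)%N.
Proof.
have lt m : (residue a m <= 2 ^ m)%N.
  by rewrite -residue_mod ltnW // ltn_mod expn_gt0.
apply/eqP; rewrite modn_mod2 -(eqn_modDr (residue a n)) subnK //.
rewrite (residue_compat a n) modnDmr subnK //.
by rewrite expnS modnMl modnn.
Qed.
Definition Z2adic_opp a := Z2Adic (opp_compat a).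

Fact Z2adic_addC : commutative Z2adic_add.
Proof. by move=> a b; apply: residue_inj => n /=; rewrite addnC. Qed.
Fact Z2adic_addA : associative Z2adic_add.
Proof.
by move=> a b c; apply: residue_inj => n /=; rewrite modnDml modnDmr addnA.
Qed.
Fact Z2adic_add0 : left_id Z2adic_zero Z2adic_add.
Proof. by move=> a; apply: residue_inj => n /=; exact: residue_mod. Qed.
Fact Z2adic_addr0 : right_id Z2adic_zero Z2adic_add.
Proof. by move=> a; rewrite Z2adic_addC Z2adic_add0. Qed.
Fact Z2adic_addN : left_inverse Z2adic_zero Z2adic_opp Z2adic_add.
Proof.
move=> a; apply: residue_inj => n /=; rewrite modnDml subnK ?modnn //.
by rewrite -residue_mod ltnW // ltn_mod expn_gt0.
Qed.
Fact Z2adic_addrN : right_inverse Z2adic_zero Z2adic_opp Z2adic_add.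
Proof. by move=> a; rewrite Z2adic_addC Z2adic_addN. Qed.

HB.instance Definition _ := isGroup.Build Z2adic
  Z2adic_addA Z2adic_add0 Z2adic_addr0 Z2adic_addN Z2adic_addrN.

Lemma Z2adic_center (A : set Z2adic) : A `<=` group_center Z2adic.
Proof. by move=> a _ b; exact: Z2adic_addC. Qed.
End Z2adicGroup.

(* The subspace topology of the product of the discrete sets of residues *)
HB.instance Definition _ := Topological.copy Z2adic
  (initial_topology (residue : Z2adic -> prod_topology (fun _ : nat => nat))).

(* Main.v *)
Require Import Defs.
From HB Require Import structures.
From mathcomp Require Import all_boot all_order all_algebra.
From mathcomp Require Import all_classical all_reals all_analysis.
From mathcomp Require Import zify ring lra.
Import numFieldNormedType.Exports.

(** Write pi for the projection of X * Y onto G = (X * Y) / graph(u).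

    The covering p from X to SL_2 identifies the centre Z of X with the elements
    lying over 1 and -1, so Z is discrete and the graph of u over Z is closed:
    G is Hausdorff, and it is locally compact because X and Y are.  Modulo the
    graph, a point (1, u z) equals (1 / z, 1), so pi (X * 1) is also
    pi (X * <y>); it is connected, and dense since <y> is dense in Y.  Hence G
    is connected.

    Suppose that G = K L.  The square of the trace of p a is a continuous
    function of the class of (a, b), so it is bounded on the compact group K.
    A normal subgroup of SL_2 on which the trace is bounded contains at most 1
    and -1 (bounded_normal_SL2), so K lies in pi (Z * Y) = pi (1 * Y), which is
    totally disconnected like Y; as K is connected, it is trivial
    (compact_connected_normal_trivial).

    Thus L = G, and G has a finer topology making it a connected Lie group.
    Such a topology is locally connected.  Near 1 the group G looks like V * Y
    with V open in X, so small connected neighbourhoods of 1 in the finer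
    topology stay in pi (V * 1) (small_connected).  Therefore pi (X * 1) is an
    open subgroup for that topology, whence equal to G
    (locally_connected_image).  But pi (1, b) belongs to pi (X * 1) only when b
    is in <y>, so <y> = Y.  This is absurd: y is divisible by 3 in Y, but not in
    <y>, because it has infinite order (dense_cyclic_proper). *)

Set Implicit Arguments.
Unset Strict Implicit.
Unset Printing Implicit Defensive.

Local Open Scope classical_set_scope.
Local Open Scope group_scope.

(** * Topological groups *)

Lemma continuous_compT (S T U : topologicalType) (f : S -> T) (g : T -> U) :
  continuous f -> continuous g -> continuous (fun s => g (f s)).
Proof. by move=> cf cg s; exact: (continuous_comp (cf s) (cg (f s))). Qed.

Lemma continuous_fst (S T : topologicalType) : continuous (@fst S T).
Proof. by move=> s; exact: cvg_fst. Qed.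

Lemma continuous_snd (S T : topologicalType) : continuous (@snd S T).
Proof. by move=> s; exact: cvg_snd. Qed.

Lemma continuous_pair (S T U : topologicalType) (f : S -> T) (g : S -> U) :
  continuous f -> continuous g -> continuous (fun s => (f s, g s)).
Proof.
move=> cf cg s W [[A B] /= [nA nB] AB].
have nfA : nbhs s (f @^-1` A) by exact: cf.
have ngB : nbhs s (g @^-1` B) by exact: cg.
change (nbhs s [set s' | W (f s', g s')]).
by apply: filterS (filterI nfA ngB) => s' [/= fA gB]; exact: (AB (f s', g s')).
Qed.

Section TopologicalGroup.
Variables (G : preTopologicalGroupType) (tG : topological_group G).

Lemma mulg_nbhs (a b : G) (W : set G) : nbhs (a * b) W ->
  exists A B : set G, [/\ nbhs a A, nbhs b B &
    forall a' b', A a' -> B b' -> W (a' * b')].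
Proof.
move=> nW; have [_ cM _] := tG.
have [[A B] /= [nA nB] AB] : nbhs (a, b) ((fun z : G * G => z.1 * z.2) @^-1` W).
  exact: cM.
by exists A, B; split => // a' b' Aa' Bb'; exact: (AB (a', b')).
Qed.

Lemma continuous_mulg (T : topologicalType) (f g : T -> G) :
  continuous f -> continuous g -> continuous (fun t => f t * g t).
Proof.
move=> cf cg t W /= /mulg_nbhs[A [B [nA nB AB]]].
have nfA : nbhs t (f @^-1` A) by exact: cf.
have ngB : nbhs t (g @^-1` B) by exact: cg.
change (nbhs t [set t' | W (f t' * g t')]).
by apply: filterS (filterI nfA ngB) => t' [/= fA gB]; exact: AB.
Qed.

Lemma continuous_invg (T : topologicalType) (f : T -> G) :
  continuous f -> continuous (fun t => (f t)^-1).
Proof.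
have [_ _ cV] := tG => cf t W nW; exact: (cf t _ (cV _ _ nW)).
Qed.

Lemma nbhs_mulgl (a b : G) (W : set G) :
  nbhs (a * b) W -> nbhs b [set c | W (a * c)].
Proof.
move=> nW; apply: (@continuous_mulg G (fun=> a) id _ _ b W nW) => t.
  exact: cvg_cst.
exact: cvg_id.
Qed.

Lemma closed_center : closed (group_center G).
Proof.
have [hG _ _] := tG.
(* Equations with values in a Hausdorff group cut out closed sets. *)
rewrite (_ : group_center G =
    \bigcap_(g in setT) [set z | z * g * (g * z)^-1 = 1]); last first.
  rewrite eqEsubset; split=> z /= zZ g; first by rewrite /= zZ mulgV.
  by apply: (mulIg (g * z)^-1); rewrite (zZ g I) mulgV.
apply: closed_bigI => g _.
apply: (@preimage_closed _ _ (fun z => z * g * (g * z)^-1) [set 1]).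
  move=> t _; apply: continuous_mulg.
    by apply: continuous_mulg => s; [exact: cvg_id|exact: cvg_cst].
  apply: continuous_invg.
  by apply: continuous_mulg => s; [exact: cvg_cst|exact: cvg_id].
by apply: accessible_closed_set1; exact: hausdorff_accessible.
Qed.

End TopologicalGroup.

Lemma hausdorffP (T : topologicalType) : hausdorff_space T <->
  forall a b : T, a <> b ->
    exists A B : set T, [/\ nbhs a A, nbhs b B & A `&` B = set0].
Proof.
split=> [hT a b ab|hT a b cab].
  apply: contrapT => nAB; apply: ab; apply: hT => A B nA nB.
  apply/set0P/eqP => AB; apply: nAB; exists A, B; split=> //.
apply: contrapT => /hT[A [B [nA nB AB]]].
by have [c] := cab _ _ nA nB; rewrite AB.
Qed.

Lemma topological_group_prod (G H : preTopologicalGroupType) :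
  topological_group G -> topological_group H ->
  topological_group (G * H)%type.
Proof.
move=> tG tH; have [hG _ _] := tG; have [hH _ _] := tH.
split.
- apply/hausdorffP => -[a b] [a' b'] /= ne.
  have [ea|na] := pselect (a = a').
    have /((hausdorffP _).1 hH)[A [B [nA nB AB]]] : b <> b'.
      by move=> eb; apply: ne; rewrite ea eb.
    exists (snd @^-1` A), (snd @^-1` B); split.
    + exact: (@cvg_snd _ _ (nbhs a) (nbhs b)).
    + exact: (@cvg_snd _ _ (nbhs a') (nbhs b')).
    + by rewrite -preimage_setI AB preimage_set0.
  have /((hausdorffP _).1 hG)[A [B [nA nB AB]]] := na.
  exists (fst @^-1` A), (fst @^-1` B); split.
  + exact: (@cvg_fst _ _ (nbhs a) (nbhs b)).
  + exact: (@cvg_fst _ _ (nbhs a') (nbhs b')).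
  + by rewrite -preimage_setI AB preimage_set0.
- apply: (@continuous_pair _ _ _ (fun z : (G * H) * (G * H) => z.1.1 * z.2.1)
    (fun z : (G * H) * (G * H) => z.1.2 * z.2.2)).
    apply: (@continuous_mulg G tG _ (fst \o fst) (fst \o snd)) => t;
      apply: continuous_comp; by [exact: cvg_fst|exact: cvg_snd].
  apply: (@continuous_mulg H tH _ (snd \o fst) (snd \o snd)) => t;
    apply: continuous_comp; by [exact: cvg_fst|exact: cvg_snd].
- apply: (@continuous_pair _ _ _ (fun z : G * H => z.1^-1)
    (fun z : G * H => z.2^-1)).
    by apply: (@continuous_invg G tG _ fst) => t; exact: cvg_fst.
  by apply: (@continuous_invg H tH _ snd) => t; exact: cvg_snd.
Qed.

(** * Quotients of topological groups *)

Section Quotient.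
Local Open Scope quotient_scope.
Variables (G : preTopologicalGroupType) (tG : topological_group G).
Variables (N : subgroup G) (nN : normal_subgroup N).
Notation Q := (quotient_group nN).
Notation pi := (\pi_Q : G -> Q).

Lemma quotient_piM (a b : G) : pi (a * b) = pi a * pi b.
Proof. by rewrite -(quotient_mulE nN). Qed.

Lemma quotient_piV (a : G) : pi a^-1 = (pi a)^-1.
Proof. by rewrite -(quotient_invE nN). Qed.

Lemma pi_eq (a b : G) : pi a = pi b <-> (N : set G) (a^-1 * b).
Proof. by rewrite quotient_eqP inE. Qed.

Lemma pi_surj (q : Q) : exists a, q = pi a.
Proof. by exists (repr q); rewrite reprK. Qed.

Lemma pi_cont : continuous pi.
Proof. exact: pi_continuous. Qed.

(** The saturation of an open set is a union of its right translates. *)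
Lemma pi_open (A : set G) : open A -> open (pi @` A).
Proof.
move=> oA; rewrite /open /= /quotient_open.
rewrite (_ : _ @^-1` _ = \bigcup_(n in (N : set G)) [set g | A (g * n)]).
  apply: bigcup_open => n _.
  apply: (@open_comp _ _ (fun g => g * n)) => // g _.
  by apply: (continuous_mulg tG) => t; [exact: cvg_id|exact: cvg_cst].
rewrite eqEsubset; split=> g /=.
  by move=> [a Aa /esym/pi_eq Na]; exists (g^-1 * a) => //=; rewrite mulVKg.
by move=> [n Nn /= Agn]; exists (g * n) => //; apply/esym/pi_eq; rewrite mulKg.
Qed.

Lemma pi_nbhs (a : G) (A : set G) : nbhs a A -> nbhs (pi a) (pi @` A).
Proof.
rewrite nbhsE => -[V [oV Va] VA].
apply: (@filterS _ _ _ (pi @` V)); first exact: image_subset.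
by apply: open_nbhs_nbhs; split; [exact: pi_open|exists a].
Qed.

(** Since the projection is open, a neighbourhood condition on the quotient can
    be checked on representatives.  Two cosets are separated by applying the
    continuity of division at a pair whose quotient avoids the closed set N. *)
Lemma topological_group_quotient :
  closed (N : set G) -> topological_group Q.
Proof.
move=> cN; split.
- apply/hausdorffP => q q'; have [a ->] := pi_surj q; have [b ->] := pi_surj q'.
  move=> ne; have nab : ~ (N : set G) (a^-1 * b) by move=> /pi_eq.
  have : nbhs (a^-1 * b) (~` (N : set G)).
    by apply: open_nbhs_nbhs; split=> //; exact: closed_openC.
  move=> /(mulg_nbhs tG)[A [B [nA nB AB]]].
  have [_ _ cV] := tG.
  exists (pi @` [set g | A g^-1]), (pi @` B); split.
  + by apply: pi_nbhs; exact: cV.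
  + exact: pi_nbhs.
  + rewrite -subset0 => _ [[g Ag <-] [h Bh /esym/pi_eq]].
    exact: AB.
- move=> [q q']; have [a ->] := pi_surj q; have [b ->] := pi_surj q' => W /=.
  rewrite -quotient_piM => /pi_cont /(mulg_nbhs tG)[A [B [nA nB AB]]].
  exists (pi @` A, pi @` B) => /=; first by split; exact: pi_nbhs.
  move=> [_ _] /= [[g Ag <-] [h Bh <-]].
  by rewrite -quotient_piM; exact: AB.
- move=> q; have [a ->] := pi_surj q => W /=.
  rewrite -quotient_piV => /pi_cont nW; have [_ _ cV] := tG.
  have /pi_nbhs := cV _ _ nW; apply: filterS => _ [g /= Wg <-].
  by rewrite -quotient_piV.
Qed.

End Quotient.

Section LocallyCompactQuotient.
Local Open Scope quotient_scope.
Variables (X Y : preTopologicalGroupType).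
Hypotheses (tX : topological_group X) (tY : topological_group Y).
Variables (N : subgroup (X * Y)%type) (nN : normal_subgroup N).
Let G := quotient_group nN.

Lemma locally_compact_quotient :
  (forall a : X, exists K, compact K /\ nbhs a K) ->
  compact [set: Y] -> hausdorff_space G -> locally_compact [set: G].
Proof.
move=> lX cY hG g _; have [[a b] ->] := pi_surj g.
have [K [cK nK]] := lX a.
pose P := (\pi_G : (X * Y)%type -> G) @` (K `*` setT).
have cP : compact P.
  apply: continuous_compact; last exact: compact_setX.
  by apply: continuous_subspaceT; exact: pi_cont.
exists P; last by split=> //; exact: compact_closed.
have nP : nbhs (\pi_G (a, b)) P.
  apply: (pi_nbhs (topological_group_prod tX tY) nN).
  by exists (K, setT) => /=; [split=> //; exact: filterT|].
by apply: filterS nP => c Pc _.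
Qed.

End LocallyCompactQuotient.

(** * Quotients by the graph of a homomorphism *)

Section Morphism.
Variables (G H : groupType) (f : G -> H).
Hypothesis fM : {morph f : a b / a * b}.

Lemma morph_mulg1 : f 1 = 1.
Proof. by apply: (mulgI (f 1)); rewrite mulg1 -fM mulg1. Qed.

Lemma morph_invg a : f a^-1 = (f a)^-1.
Proof. by apply: (mulgI (f a)); rewrite -fM !mulgV morph_mulg1. Qed.

Lemma morph_expg a n : f (a ^+ n) = f a ^+ n.
Proof.
by elim: n => [|n IHn]; rewrite ?expg0 ?morph_mulg1// !expgS fM IHn.
Qed.

End Morphism.

Lemma cyclic_morphism_surj (G H : groupType) (x : G) (y : H)
    (u : {multiplicative subg (cyclic_subgroup x) ->
                         subg (cyclic_subgroup y)}) :
  u (cyclic_gen x) = cyclic_gen y ->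
  forall h, (cyclic_subgroup y : set H) h -> exists z, val (u z) = h.
Proof.
move=> ux h [n [->|->]].
  exists (cyclic_gen x ^+ n).
  rewrite (morph_expg (@gmulfM _ _ u)) ux (morph_expg (@valM _ _ _)) //.
exists (cyclic_gen x ^- n).
rewrite (morph_invg (@gmulfM _ _ u)) (morph_expg (@gmulfM _ _ u)) ux.
by rewrite (morph_invg (@valM _ _ _)) (morph_expg (@valM _ _ _)).
Qed.

Section GraphQuotient.
Local Open Scope quotient_scope.
Variables (X Y : preTopologicalGroupType).
Variables (tX : topological_group X) (tY : topological_group Y).
Variables (Z : subgroup X) (H : subgroup Y).
Variables (u : {multiplicative subg Z -> subg H}).
Variables (cZ : (Z : set X) `<=` group_center X).
Variables (cH : (H : set Y) `<=` group_center Y).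
Let G := quotient_group (graph_normal u cZ cH).
Local Notation pi := (\pi_G : (X * Y)%type -> G).

Let tXY : topological_group (X * Y)%type := topological_group_prod tX tY.

Lemma pi_graph_eq (a a' : X) (b b' : Y) :
  pi (a, b) = pi (a', b') <->
  exists z : subg Z, a' = a * val z /\ b' = b * val (u z).
Proof.
rewrite pi_eq; split=> [[z [ea eb]]|[z [-> ->]]]; exists z.
  by split; [apply: (mulgI a^-1)|apply: (mulgI b^-1)]; rewrite mulKg.
by congr (_, _); rewrite mulKg.
Qed.

Let piM : forall w w', pi (w * w') = pi w * pi w' :=
  quotient_piM (graph_normal u cZ cH).
Let piV : forall w, pi w^-1 = (pi w)^-1 := quotient_piV (graph_normal u cZ cH).

(** The hypotheses on U express that Z is discrete. *)
Section Discrete.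
Variables (U : set X) (nU : nbhs (1 : X) U).
Hypothesis UZ : forall z, U z -> (Z : set X) z -> z = 1.

(** Near a point z of the discrete subgroup Z the graph has just the point
    (z, u z), so a limit of points of the graph over z has second coordinate
    u z. *)
Lemma closed_graph : closed (Z : set X) -> closed (graph_subgroup u : set _).
Proof.
have [hY _ _] := tY => clZ [a b] cab.
have Za : (Z : set X) a.
  apply: clZ => A nA.
  have [[a' b'] [[z [-> _]]] /= Az] :
      (graph_subgroup u : set _) `&` (fst @^-1` A) !=set0.
    by apply: cab; exact: (@cvg_fst _ _ (nbhs a) (nbhs b)).
  by exists (val z); split=> //; have /set_mem := valP z.
pose z : subg Z := Sub a (mem_set Za).
exists z; congr (_, _); apply: hY => B C nB nC.
have nU' : nbhs a [set a' | U (a^-1 * a')].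
  by apply: (nbhs_mulgl tX); rewrite mulVg.
have [[a' b'] [[z' [ea eb]]] /= [Ua Bb]] :
    (graph_subgroup u : set _) `&` ([set a' | U (a^-1 * a')] `*` B) !=set0.
  by apply: cab; exists ([set a' | U (a^-1 * a')], B).
exists b'; split => //; rewrite eb.
suff -> : z' = z by exact: nbhs_singleton.
apply: val_inj => /=; rewrite -ea.
apply: (mulgI a^-1); rewrite mulVg; apply: UZ => //.
apply: set_mem; rewrite ea.
apply: (group_closedM (subgroupP Z)); last exact: valP.
by apply: (group_closedV (subgroupP Z)); exact: mem_set.
Qed.

Section ZeroDimensional.
Hypothesis zY : zero_dimensional Y.

(** If no two points of V are congruent modulo Z, then the projection is
    injective on V * Y, so each clopen subset C of Y cuts the image of V * Y
    into two disjoint open pieces.  A connected set through 1 stays in the piece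
    that contains 1. *)
Lemma small_connected (V : set X) (S : set G) :
  open V -> (forall a a', V a -> V a' -> (Z : set X) (a^-1 * a') -> a = a') ->
  connected S -> S 1 -> S `<=` pi @` (V `*` setT) -> V 1 ->
  S `<=` pi @` (V `*` [set 1]).
Proof.
move=> oV VZ cS S1 SV V1 s Ss.
have [[a b] [/= Va _] ss] := SV _ Ss.
exists (a, b) => //; split => //=; apply: contrapT => /eqP.
rewrite eq_sym => /zY[C [[oC /closed_openC oC'] C1 nCb]].
have oVC (D : set Y) : open D -> open (pi @` (V `*` D)).
  move=> oD; apply: (pi_open tXY); rewrite openE => -[v d] [/= Vv Dd].
  by exists (V, D) => //; split; exact: open_nbhs_nbhs.
have VCE v d v' d' : V v -> V v' -> pi (v, d) = pi (v', d') -> d = d'.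
  move=> Vv Vv' /pi_graph_eq[z [ev ed]].
  have : v = v'.
    by apply: VZ => //; rewrite ev mulKg; have /set_mem := valP z.
  rewrite ev -{1}(mulg1 v) => /mulgI z1.
  have ze : z = 1 by exact: val_inj.
  have u1 : u 1 = 1 by apply: morph_mulg1; exact: gmulfM.
  by rewrite ed ze u1 val1 mulg1.
have SE : S `&` pi @` (V `*` C) = S.
  apply: cS.
  - by exists 1; split=> //; exists (1, 1).
  - by exists (pi @` (V `*` C)) => //; exact: oVC.
  - exists (~` (pi @` (V `*` ~` C))); first by apply/open_closedC/oVC.
    rewrite eqEsubset; split=> t [St].
      move=> [[v d] [/= Vv Cd] tE]; split=> // -[[v' d'] [/= Vv' Cd']].
      rewrite -tE => /VCE e.
      by apply: Cd'; rewrite e.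
    move=> nt; split=> //; have [[v d] [/= Vv _] tE] := SV _ St.
    exists (v, d) => //; split=> //=; apply: contrapT => nC; apply: nt.
    by exists (v, d).
have : (S `&` pi @` (V `*` C)) s by rewrite SE.
move=> [_ [[v d] [/= Vv Cd]]]; rewrite -ss => /VCE e.
by apply: nCb; rewrite -e.
Qed.

Lemma small_nbhs : exists V : set X, [/\ open V, V 1 &
  forall a a', V a -> V a' -> (Z : set X) (a^-1 * a') -> a = a'].
Proof.
have [_ _ cV] := tX.
have /(mulg_nbhs tX)[A [B [nA nB AB]]] : nbhs ((1 : X)^-1 * 1) U.
  by rewrite mulVg.
have nAV : nbhs (1 : X) [set a | A a^-1] by exact: cV.
have : nbhs (1 : X) ([set a | A a^-1] `&` B) by exact: filterI.
rewrite nbhsE => -[V [oV V1] VAB].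
exists V; split=> // a a' /VAB[/= Aa _] /VAB[_ Ba'] Zaa'.
by apply: (mulgI a^-1); rewrite mulVg; apply/esym/UZ => //; exact: AB.
Qed.

(** The preimage D of the image of X * 1 is a subgroup.  A small connected
    neighbourhood of 1 in T lands in the image of some V * Y as above, hence in
    that of V * 1, so D is open; an open subgroup is closed, and T is
    connected. *)
Lemma locally_connected_image (T : preTopologicalGroupType)
    (f : T -> G) :
  {morph f : s t / s * t} ->
  topological_group T -> connected [set: T] ->
  (forall N : set T, nbhs 1 N ->
     exists W, [/\ nbhs 1 W, W 1, connected W & W `<=` N]) ->
  continuous f -> forall t, exists a, f t = pi (a, 1).
Proof.
move=> fM tT cT lcT cf t.
have [V [oV V1 VZ]] := small_nbhs.
pose D := [set t | exists a, f t = pi (a, 1)].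
have nV : nbhs (1 : T) (f @^-1` (pi @` (V `*` setT))).
  apply: cf; rewrite (morph_mulg1 fM).
  apply: (@pi_nbhs _ tXY _ (graph_normal u cZ cH) (1, 1)).
  exists (V, setT) => //.
  by split=> /=; [exact: open_nbhs_nbhs|exact: filterT].
have [W [nW W1 cW WV]] := lcT _ nV.
have WD : W `<=` D.
  move=> w Ww.
  have : (f @` W) `<=` pi @` (V `*` [set 1]).
    apply: small_connected => //.
    - apply: connected_continuous_connected => //; exact: continuous_subspaceT.
    - by exists 1 => //; rewrite (morph_mulg1 fM).
    - by move=> _ [w' /WV Vw' <-].
  by move=> /(_ (f w)) []; [exists w|move=> [a b] [/= _ ->] fw; exists a].
have nD s : nbhs s [set r | W (s^-1 * r)].
  by apply: (nbhs_mulgl tT); rewrite mulVg.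
have DM s r : D s -> W (s^-1 * r) -> D r.
  move=> [a fs] /WD[b fr]; exists (a * b).
  by rewrite -(mulVKg s r) fM fs fr -piM; congr (pi (_, _)); rewrite mulg1.
have DM' s r : D r -> W (s^-1 * r) -> D s.
  move=> [a fr] /WD[b fs]; exists (a * b^-1).
  have -> : s = r * (s^-1 * r)^-1 by rewrite invgM invgK mulVKg.
  rewrite fM (morph_invg fM) fr fs -piV -piM.
  by congr (pi (_, _)); exact: mulgV.
suff : D = [set: T] by move=> DT; have : D t by rewrite DT.
apply: cT.
- by exists 1; exists 1; rewrite (morph_mulg1 fM).
- exists D; rewrite ?setTI// openE => s Ds; apply: filterS (nD s) => r /=.
  exact: DM.
- exists D; rewrite ?setTI// => s cs.
  by have [r [Dr /= Wr]] := cs _ (nD s); exact: DM' Wr.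
Qed.

End ZeroDimensional.
End Discrete.

(** Points (a, u z) and (a / z, 1) have the same class, so the image of X * 1 is
    that of X * H, which is dense. *)
Lemma connected_graph_quotient :
  (forall h, (H : set Y) h -> exists z, val (u z) = h) ->
  connected [set: X] -> closure (H : set Y) = setT -> connected [set: G].
Proof.
move=> su cX dH.
have <- : closure (range (fun a : X => pi (a, 1))) = setT.
  rewrite -subTset => g _ W; have [[a b] ->] := pi_surj g.
  move=> nW; have [[A B] /= [nA nB] AB] : nbhs (a, b) (pi @^-1` W).
    exact: (@pi_cont _ _ (graph_normal u cZ cH) (a, b) W nW).
  have : closure (H : set Y) b by rewrite dH.
  move=> /(_ _ nB)[_ [/su[z <-] Bu]].
  exists (pi (a, val (u z))); split; last first.
    by apply: (AB (a, _)); split=> //=; exact: nbhs_singleton.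
  exists (a * (val z)^-1) => //; apply/pi_graph_eq; exists z.
  by rewrite mulgVK mul1g.
apply: connected_closure; apply: connected_continuous_connected => //.
apply: continuous_subspaceT.
have cp : continuous (fun a : X => (a, 1 : Y)).
  by apply: continuous_pair => s; [exact: cvg_id|exact: cvg_cst].
by move=> a; apply: continuous_comp; [exact: cp|exact: pi_cont].
Qed.

End GraphQuotient.

(** * The topological group of 2-adic integers *)

(** A cluster point in K comes from a point of the source, because K lies in the
    range. *)
Lemma compact_initial (S : choiceType) (T : topologicalType) (f : S -> T)
    (K : set T) :
  compact K -> K `<=` range f -> compact (f @^-1` K : set (initial_topology f)).
Proof.
move=> cK Kf F FF FK.
have [t [Kt clt]] := cK (f @ F) _ FK.
have [s _ fs] := Kf _ Kt; exists s; split; first by rewrite /preimage /= fs.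
move=> A B FA [_ [[W oW <-] Ws] WB].
have fFA : (f @ F) (f @` A).
  by change (F (f @^-1` (f @` A))); apply: filterS FA => a Aa; exists a.
have nW : nbhs t W by apply: open_nbhs_nbhs; split=> //; rewrite -fs.
have [_ [[a Aa <-] Wa]] := clt _ _ fFA nW.
by exists a; split=> //; exact: WB.
Qed.

Lemma continuous_prod_topology (I : Type) (S : topologicalType)
    (T : I -> topologicalType) (f : S -> prod_topology T) :
  (forall i, continuous (fun s => f s i)) -> continuous f.
Proof.
move=> cf s; apply/cvg_sup => i.
have ci : continuous (f : S -> initial_topology (fun g : forall i, T i => g i)).
  by apply: continuous_comp_initial; exact: cf.
exact: ci.
Qed.

Lemma continuous_nat2 (S : topologicalType) (f g : S -> nat)
    (h : nat -> nat -> nat) :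
  continuous f -> continuous g -> continuous (fun s => h (f s) (g s)).
Proof.
move=> cf cg s W nW; have Wh : W (h (f s) (g s)) := nbhs_singleton nW.
have n1 (k : nat) : nbhs k [set k].
  by apply: open_nbhs_nbhs; split; [exact: discrete_open|].
have nf : nbhs s (f @^-1` [set f s]) by apply: cf; exact: n1.
have ng : nbhs s (g @^-1` [set g s]) by apply: cg; exact: n1.
change (nbhs s [set t | W (h (f t) (g t))]).
by apply: filterS (filterI nf ng) => t [/= -> ->].
Qed.

Lemma continuous_residues :
  continuous (residue : Z2adic -> prod_topology (fun _ : nat => nat)).
Proof. exact: initial_continuous. Qed.

Lemma continuous_residue n : continuous (fun a : Z2adic => residue a n).
Proof.
move=> a; exact: (continuous_comp (@continuous_residues a)
  (@proj_continuous nat (fun _ : nat => nat) n (residue a))).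
Qed.

Lemma continuous_Z2adic (S : topologicalType) (f : S -> Z2adic) :
  (forall n, continuous (fun s => residue (f s) n)) -> continuous f.
Proof.
by move=> cf; apply: continuous_comp_initial; exact: continuous_prod_topology.
Qed.

Lemma clopen_residue (n k : nat) : clopen [set a | residue a n = k].
Proof.
split.
  apply: (@open_comp _ _ (residue^~ n) [set k]); last exact: discrete_open.
  by move=> a _; exact: continuous_residue.
apply: (@preimage_closed _ _ (residue^~ n) [set k]) => [a _|].
  exact: continuous_residue.
exact: discrete_closed.
Qed.

Lemma zero_dimensional_Z2adic : zero_dimensional Z2adic.
Proof.
move=> a b /eqP ab; have [n ne] : exists n, residue a n <> residue b n.
  by apply/existsNP => e; exact/ab/residue_inj.
exists [set c | residue c n = residue a n]; split=> //; last exact: nesym.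
exact: clopen_residue.
Qed.

Lemma topological_group_Z2adic : topological_group Z2adic.
Proof.
split.
- apply/hausdorffP => a b /eqP/zero_dimensional_Z2adic[C [[oC cC] Ca Cb]].
  exists C, (~` C); split; [exact: open_nbhs_nbhs| |by rewrite setICr].
  by apply: open_nbhs_nbhs; split=> //; exact: closed_openC.
- apply: continuous_Z2adic => n /=.
  apply: (@continuous_nat2 _ (fun z : Z2adic * Z2adic => residue z.1 n)
    (fun z => residue z.2 n) (fun i j => (i + j) %% 2 ^ n)%N).
    exact: (continuous_compT (@continuous_fst _ _) (@continuous_residue n)).
  exact: (continuous_compT (@continuous_snd _ _) (@continuous_residue n)).
- apply: continuous_Z2adic => n /=.
  by apply: (@continuous_nat2 _ (residue^~ n) (residue^~ n)
    (fun i _ => (2 ^ n - i) %% 2 ^ n)%N); exact: continuous_residue.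
Qed.

(** The compatible families form a closed subset of the product of the finite
    sets of residues. *)
Lemma compact_Z2adic : compact [set: Z2adic].
Proof.
pose K := [set f : prod_topology (fun _ : nat => nat) |
  forall n, f n = (f n.+1 %% 2 ^ n)%N].
have cK : compact K.
  apply: (@subclosed_compact _ _
    [set f : prod_topology (fun _ : nat => nat) | forall n, `I_(2 ^ n) (f n)]).
  - rewrite (_ : K = \bigcap_n [set f | f n = (f n.+1 %% 2 ^ n)%N]).
      apply: closed_bigI => n _.
      rewrite (_ : mkset _ = (fun f : prod_topology (fun _ : nat => nat) =>
          (f n == f n.+1 %% 2 ^ n)%N : nat) @^-1` [set 1%N]).
        apply: preimage_closed => [f _|]; last exact: discrete_closed.
        apply: (@continuous_nat2 _
          (fun f : prod_topology (fun _ : nat => nat) => f n)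
          (fun f => f n.+1) (fun i j => (i == j %% 2 ^ n)%N : nat));
          exact: (@proj_continuous nat (fun _ : nat => nat)).
      by rewrite eqEsubset; split=> f /=; [move=> ->; rewrite eqxx|case: eqP].
    by rewrite eqEsubset; split=> f fE n; [move=> _; exact: fE|exact: (fE n I)].
  - apply: (@tychonoff nat (fun _ => nat) (fun n => `I_(2 ^ n))) => n.
    by apply: finite_compact; exact: finite_II.
  - by move=> f fE n /=; rewrite fE ltn_mod expn_gt0.
have -> : [set: Z2adic] = residue @^-1` K.
  by rewrite eqEsubset; split=> a //= _ n; exact: residue_compat.
apply: (@compact_initial Z2adic (prod_topology (fun _ : nat => nat)) residue)
  => //.
by move=> f fK; exists (Z2Adic fK).
Qed.

Lemma Z2adic_expE (a : Z2adic) k n :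
  residue (a ^+ k) n = (k * residue a n %% 2 ^ n)%N.
Proof.
elim: k => [|k IHk]; first by rewrite mul0n mod0n.
by rewrite expgS mulSn /= IHk modnDmr.
Qed.

(** This is (2 ^ (2 * n + 1) + 1) / 3, which inverts 3 modulo 2 ^ n; the
    recursion shows it to be integral and compatible with reduction. *)
Fixpoint third_approx (n : nat) : nat :=
  if n is m.+1 then third_approx m + 2 ^ m.*2.+1 else 1.

Lemma third_approxE n : (3 * third_approx n = 2 ^ n.*2.+1 + 1)%N.
Proof.
elim: n => // n IHn; rewrite [third_approx _]/= mulnDr IHn doubleS !expnS.
by set e := (2 ^ n.*2)%N; lia.
Qed.

Lemma third_compat (y : Z2adic) n :
  (residue y n * third_approx n %% 2 ^ n =
   (residue y n.+1 * third_approx n.+1 %% 2 ^ n.+1) %% 2 ^ n)%N.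
Proof.
rewrite modn_dvdm; last by rewrite expnS dvdn_mull.
rewrite /= mulnDr -modnDmr (_ : _ * 2 ^ _ %% 2 ^ n = 0)%N; last first.
  by apply/eqP; rewrite -/(dvdn _ _) dvdn_mull// dvdn_exp2l// -addnn; lia.
by rewrite addn0 (residue_compat y n) modnMml.
Qed.

Lemma Z2adic_third (y : Z2adic) : exists b : Z2adic, b ^+ 3 = y.
Proof.
exists (Z2Adic (third_compat y)); apply: residue_inj => n.
rewrite Z2adic_expE /= modnMmr mulnCA third_approxE mulnDr muln1.
rewrite -modnDml (_ : _ * 2 ^ _ %% 2 ^ n = 0)%N ?add0n ?residue_mod//.
by apply/eqP; rewrite -/(dvdn _ _) dvdn_mull// dvdn_exp2l// -addnn; lia.
Qed.

Section DenseCyclic.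
Variables (y : Z2adic) (hy : closure (cyclic_subgroup y) = [set: Z2adic]).

Let one_compat n : (1 %% 2 ^ n = (1 %% 2 ^ n.+1) %% 2 ^ n)%N.
Proof. by rewrite modn_dvdm// expnS dvdn_mull. Qed.

(** Otherwise the generated subgroup lies in the clopen set of even numbers and
    misses a neighbourhood of 1. *)
Lemma odd_dense_generator n : odd (residue y n.+1).
Proof.
elim: n => [|n IHn]; last first.
  by move: IHn; rewrite residue_compat odd_mod// oddX.
have r2 : (residue y 1 < 2)%N by rewrite -residue_mod ltn_mod.
suff : residue y 1 <> 0%N by case: (residue y 1) r2 => [|[|]].
move=> y0; have [oC _] := clopen_residue 1 1.
have : closure (cyclic_subgroup y) (Z2Adic one_compat) by rewrite hy.
move=> /(_ [set a | residue a 1 = 1%N]) [].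
  by apply: open_nbhs_nbhs; split.
move=> _ [[k [->|->]]] /=; rewrite ?Z2adic_expE y0 muln0 //.
Qed.

Lemma dense_generator_order k : y ^+ k = 1 -> k = 0%N.
Proof.
move=> yk; apply/eqP; rewrite eqn0Ngt; apply/negP => k0.
have : (2 ^ k.+1 %| k * residue y k.+1)%N.
  by rewrite /dvdn -Z2adic_expE yk.
rewrite Gauss_dvdl; last by rewrite coprimeXl// coprime2n odd_dense_generator.
by move=> /(dvdn_leq k0); rewrite leqNgt ltnW// ltn_expl.
Qed.

(** A third b of the generator y is not a multiple k y: that would give
    (3 k - 1) y = 0 for an element y of infinite order. *)
Lemma dense_cyclic_proper : exists b, ~ (cyclic_subgroup y : set Z2adic) b.
Proof.
have [b b3] := Z2adic_third y; exists b => -[k [bE|bE]].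
  have y3k : y ^+ (k * 3) = y by rewrite expgnA -bE b3.
  have [k0|k0] := posnP k.
    have /dense_generator_order : y ^+ 1 = 1 by rewrite -[LHS]y3k k0.
    by [].
  have /dense_generator_order : y ^+ (k * 3).-1 = 1.
    by apply: (mulgI y); rewrite -expgS prednK ?mulg1 ?muln_gt0 ?k0.
  by lia.
have /dense_generator_order : y ^+ (k * 3).+1 = 1.
  by rewrite expgS -{1}b3 bE expVgn -expgnA mulVg.
by [].
Qed.

End DenseCyclic.

(** * Local connectedness of Lie groups *)

Section Balls.
Import Order.TTheory GRing.Theory Num.Theory.

(** A ball is the union of the segments issuing from its centre. *)
Lemma ball_connected (R : realType) (V : normedModType R) (v : V) (e : R) :
  (0 < e)%R -> connected (ball v e).
Proof.
move=> e0; have -> : ball v e = \bigcup_(w in ball v e)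
    ((fun t : R => v + t *: (w - v))%R @` `[0%R, 1%R]).
  rewrite eqEsubset; split=> w.
    move=> vw; exists w => //; exists 1%R; last by rewrite scale1r addrC subrK.
    by rewrite /= in_itv /= ler01 lexx.
  move=> [w' vw' [t /= t01 <-]]; move: vw' t01.
  rewrite -!ball_normE /= in_itv /= => vw' /andP[t0 t1].
  rewrite opprD addNKr normrN normrZ ger0_norm//.
  apply: le_lt_trans vw'; rewrite distrC -[leRHS]mul1r.
  by apply: ler_wpM2r.
apply: bigcup_connected.
  exists v => w _ /=; exists 0%R; last by rewrite scale0r addr0.
  by rewrite /= in_itv /= ler01 lexx.
move=> w _; apply: connected_continuous_connected.
  exact: segment_connected.
apply: continuous_subspaceT => t; apply: cvgD; first exact: cvg_cst.
by apply: cvgZr_tmp.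
Qed.

End Balls.

Lemma lie_group_locally_connected (R : realType) (T : preTopologicalGroupType) :
  lie_group R T -> forall N : set T, nbhs 1 N ->
  exists W, [/\ nbhs 1 W, W 1, connected W & W `<=` N].
Proof.
move=> [_ _ [n [A [[chA covA _] _ _]]]] N nN.
have [[D C f g] Ac /= D1] := covA 1.
have [/= oD oC [fDC gCD [gf fg] cf cg]] := chA _ Ac.
move: cf cg; rewrite !continuous_open_subspace// => cf cg.
have C1 : C (f 1) by exact: fDC.
have ngN : nbhs (f 1) (g @^-1` N).
  by apply: cg; [exact: mem_set|rewrite gf].
have nC : nbhs (f 1) C by exact: open_nbhs_nbhs.
have /nbhs_ballP[e /= e0 eCN] :
    nbhs (f 1) (g @^-1` N `&` C) by exact: filterI.
exists (g @` ball (f 1) e); split.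
- have nf : nbhs 1 (f @^-1` ball (f 1) e).
    by apply: cf; [exact: mem_set|exact: nbhsx_ballx].
  have nD : nbhs 1 D by exact: open_nbhs_nbhs.
  apply: filterS (filterI nf nD) => t [/= ft Dt].
  by exists (f t) => //; exact: gf.
- by exists (f 1); [exact: ballxx|exact: gf].
- apply: connected_continuous_connected; first exact: ball_connected.
  apply: continuous_in_subspaceT => t /set_mem /eCN[_ Ct].
  by apply: cg; exact: mem_set.
- by move=> _ [t /eCN[Nt _] <-].
Qed.

(** * Normal subgroups of SL_2 with bounded traces *)

Section MatrixSize2.
Local Open Scope ring_scope.
Import Order.TTheory GRing.Theory Num.Theory.

Definition mx2 (R : Type) (a b c d : R) : 'M[R]_2 :=
  \matrix_(i, j) if i == 0 then (if j == 0 then a else b)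
                 else (if j == 0 then c else d).

Variant ord2_spec : 'I_2 -> Type := Ord2_0 : ord2_spec 0 | Ord2_1 : ord2_spec 1.

Lemma ord2P i : ord2_spec i.
Proof.
case: i => [[|[|//]] hi].
  by rewrite (_ : Ordinal hi = 0); [exact: Ord2_0|exact: val_inj].
by rewrite (_ : Ordinal hi = 1); [exact: Ord2_1|exact: val_inj].
Qed.

Section Matrix2.
Variable R : comNzRingType.
Implicit Types a b c d : R.

Lemma mx2_eta (A : 'M[R]_2) : A = mx2 (A 0 0) (A 0 1) (A 1 0) (A 1 1).
Proof.
apply/matrixP => i j; rewrite mxE.
by case: (ord2P i); case: (ord2P j).
Qed.

Lemma mx2_mul a b c d a' b' c' d' : mx2 a b c d *m mx2 a' b' c' d' =
  mx2 (a * a' + b * c') (a * b' + b * d') (c * a' + d * c') (c * b' + d * d').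
Proof.
apply/matrixP => i j; rewrite !mxE !big_ord_recl big_ord0 !mxE /= addr0.
by case: (ord2P i); case: (ord2P j).
Qed.

Lemma mx2_scalar a : a%:M = mx2 a 0 0 a.
Proof.
apply/matrixP => i j; rewrite !mxE.
by case: (ord2P i); case: (ord2P j).
Qed.

Lemma mx2_det a b c d : \det (mx2 a b c d) = a * d - b * c.
Proof.
rewrite (expand_det_row _ 0) !big_ord_recl big_ord0 /cofactor !det_mx11 !mxE /=.
by rewrite expr0 expr1 mul1r addr0 mulN1r mulrN.
Qed.

Lemma mx2_tr a b c d : \tr (mx2 a b c d) = a + d.
Proof. by rewrite /mxtrace !big_ord_recl big_ord0 !mxE /= addr0. Qed.

End Matrix2.

Lemma val_SL1 (R : comUnitRingType) n : val (1%g : SL R n) = 1%:M.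
Proof. by []. Qed.

Lemma val_SLM (R : comUnitRingType) n (A B : SL R n) :
  val (A * B)%g = val A *m val B.
Proof. by []. Qed.

Section SL2Real.
Variable R : realFieldType.
Implicit Types a b c d s : R.

Fact upper_subproof s : \det (mx2 1 s 0 1) == 1.
Proof. by rewrite mx2_det mulr0 subr0 mulr1. Qed.
Fact lower_subproof s : \det (mx2 1 0 s 1) == 1.
Proof. by rewrite mx2_det mul0r subr0 mulr1. Qed.
Definition upper s : SL R 2 := Sub (mx2 1 s 0 1) (upper_subproof s).
Definition lower s : SL R 2 := Sub (mx2 1 0 s 1) (lower_subproof s).

Lemma upperV s : (upper s)^-1%g = upper (- s).
Proof.
apply: (@mulgI _ (upper s)); rewrite mulgV; apply: val_inj.
by rewrite val_SL1 val_SLM !SubK mx2_mul mx2_scalar; congr mx2; ring.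
Qed.

Lemma lowerV s : (lower s)^-1%g = lower (- s).
Proof.
apply: (@mulgI _ (lower s)); rewrite mulgV; apply: val_inj.
by rewrite val_SL1 val_SLM !SubK mx2_mul mx2_scalar; congr mx2; ring.
Qed.

Lemma conj_upper (A : SL R 2) a b c d s : val A = mx2 a b c d ->
  val (A ^ upper s)%g =
  mx2 (a - s * c) (b + s * (a - d) - s ^+ 2 * c) c (d + s * c).
Proof.
move=> AE; rewrite conjgE upperV.
rewrite !val_SLM !SubK AE !mx2_mul.
by congr mx2; ring.
Qed.

Lemma conj_lower (A : SL R 2) a b c d s : val A = mx2 a b c d ->
  val (A ^ lower s)%g =
  mx2 (a + s * b) b (c - s * (a - d) - s ^+ 2 * b) (d - s * b).
Proof.
move=> AE; rewrite conjgE lowerV.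
rewrite !val_SLM !SubK AE !mx2_mul.
by congr mx2; ring.
Qed.

Lemma bounded_quadratic (k c M : R) :
  (forall s, `|k - s ^+ 2 * c ^+ 2| <= M) -> c = 0.
Proof.
move=> kM; apply/eqP; apply: contraT => c0.
(* At s = t / c the quadratic takes the value k - t ^ 2, which is below - M. *)
pose t := `|k| + M + 1.
have := kM (t / c); rewrite exprMn exprVn mulfVK ?expf_neq0//.
have M0 : 0 <= M by exact: le_trans (kM 0).
have := ler_norm k; have := normr_ge0 k.
rewrite ler_norml => k0 kk /andP[h _].
by move: h; rewrite /t expr2; nra.
Qed.

(** Let A have lower left entry c.  The trace of A ^ upper s * A is a quadratic
    polynomial in s with leading coefficient - c ^ 2, so boundedness forces
    c = 0.  Lower unipotent matrices show in the same way that the upper right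
    entry vanishes.  This applies to the conjugate of diag(a, d) by upper 1,
    whose upper right entry is a - d. *)
Lemma bounded_normal_SL2 (N : set (SL R 2)) (M : R) :
  (forall A g, N A -> N (A ^ g)%g) ->
  (forall A B, N A -> N B -> `|\tr (val (A * B)%g)| <= M) ->
  forall A, N A -> val A = 1%:M \/ val A = (-1)%:M.
Proof.
move=> NJ NM A NA.
have := valP A; have := mx2_eta (val A).
move: (val A 0 0) (val A 0 1) (val A 1 0) (val A 1 1) => a b c d AE.
have c0 : c = 0.
  apply: (@bounded_quadratic (a ^+ 2 + d ^+ 2 + 2 * b * c) _ M) => s.
  have := NM _ _ (NJ _ (upper s) NA) NA.
  rewrite val_SLM (conj_upper s AE) AE mx2_mul mx2_tr.
  by congr (`|_| <= _); ring.
have b0 : b = 0.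
  apply: (@bounded_quadratic (a ^+ 2 + d ^+ 2 + 2 * b * c) _ M) => s.
  have := NM _ _ (NJ _ (lower s) NA) NA.
  rewrite val_SLM (conj_lower s AE) AE mx2_mul mx2_tr.
  by congr (`|_| <= _); ring.
have ad : a = d.
  have NU := NJ _ (upper 1) NA.
  have UE := conj_upper 1 AE.
  suff : b + 1 * (a - d) - 1 ^+ 2 * c = 0 by rewrite b0 c0; lra.
  apply: (@bounded_quadratic ((a - 1 * c) ^+ 2 + (d + 1 * c) ^+ 2 +
    2 * (b + 1 * (a - d) - 1 ^+ 2 * c) * c) _ M) => s.
  have := NM _ _ (NJ _ (lower s) NU) NU.
  rewrite val_SLM (conj_lower s UE) UE mx2_mul mx2_tr.
  by congr (`|_| <= _); ring.
rewrite AE b0 c0 ad mx2_det mulr0 subr0 -expr2 sqrf_eq1 !mx2_scalar.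
by case/orP => /eqP ->; [left|right].
Qed.

(** A central element is alone in its conjugacy class, so the trace is bounded
    there. *)
Lemma center_SL2 (A : SL R 2) : group_center (SL R 2) A ->
  val A = 1%:M \/ val A = (-1)%:M.
Proof.
move=> cA; apply: (@bounded_normal_SL2 [set A] `|\tr (val (A * A)%g)|) => //.
  by move=> _ g ->; rewrite /= conjgE cA mulKg.
by move=> _ _ -> ->.
Qed.

End SL2Real.

End MatrixSize2.

(** * Covering spaces and the topology of SL_2 *)

Section CoveringsAndMatrices.
Local Open Scope ring_scope.
Import Order.TTheory GRing.Theory Num.Theory.

Lemma simply_connected_connected (R : realType) (T : topologicalType) (a : T) :
  simply_connected R T -> connected [set: T].
Proof.
move=> [pT _].
have -> : [set: T] = \bigcup_(f in [set f : R -> T |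
    {within `[0, 1], continuous f} /\ f 0 = a]) (f @` `[0, 1]).
  rewrite eqEsubset; split=> // b _; have [f [cf f0 f1]] := pT a b.
  by exists f => //; exists 1 => //; rewrite /= in_itv /= ler01 lexx.
apply: bigcup_connected.
  by exists a => f [_ f0]; exists 0 => //; rewrite /= in_itv /= ler01 lexx.
move=> f [cf _]; apply: connected_continuous_connected => //.
exact: segment_connected.
Qed.

Section Covering.
Variables (E B : topologicalType) (p : E -> B) (hp : covering_map p).

Lemma covering_locally_injective (e : E) : exists U : set E,
  nbhs e U /\ forall a a', U a -> U a' -> p a = p a' -> a = a'.
Proof.
have [_ _ /(_ (p e))[V [oV Vp [I [U [s [pV _ Us]]]]]]] := hp.
have [i _ Ui] : (\bigcup_i U i) e by rewrite -pV.
have [oU [_ _ [sp _] _ _]] := Us i.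
exists (U i); split; first exact: open_nbhs_nbhs.
by move=> a a' Ua Ua' pa; rewrite -(sp a)// -(sp a')// pa.
Qed.

Lemma covering_compact_nbhs :
  (forall (b : B) V, nbhs b V ->
     exists K : set B, [/\ compact K, nbhs b K & K `<=` V]) ->
  forall e : E, exists K : set E, compact K /\ nbhs e K.
Proof.
move=> lcB e.
have [cp _ /(_ (p e))[V [oV Vp [I [U [s [pV _ Us]]]]]]] := hp.
have [i _ Ui] : (\bigcup_i U i) e by rewrite -pV.
have [oU [_ _ [sp _] _ cs]] := Us i.
have [K [cK nK KV]] := lcB _ _ (open_nbhs_nbhs (conj oV Vp)).
exists (s i @` K); split.
  by apply: continuous_compact => //; exact: continuous_subspaceW cs.
have npK : nbhs e (p @^-1` K) by exact: cp.
have nU : nbhs e (U i) by exact: open_nbhs_nbhs.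
apply: filterS (filterI npK nU) => a [/= Ka Ua].
by exists (p a) => //; exact: sp.
Qed.

End Covering.

Section SL2Topology.
Variable R : realType.

Lemma compact_mx_box m n (B : 'M[R]_(m, n)) (c : R) :
  compact [set M : 'M[R]_(m, n) |
    forall i j, M i j \in `[B i j - c, B i j + c]].
Proof.
have -> : [set M : 'M[R]_(m, n) |
    forall i j, M i j \in `[B i j - c, B i j + c]] =
    vec_mx @` [set v : 'rV[R]_(m * n) | forall k,
      `[mxvec B 0 k - c, mxvec B 0 k + c]%classic (v ord0 k)].
  rewrite eqEsubset; split=> [M MB|_ [v vB <-] i j].
    exists (mxvec M); last exact: mxvecK.
    by move=> k; case/mxvec_indexP: k => i j; rewrite !mxvecE; exact: MB.
  by rewrite mxE; have := vB (mxvec_index i j); rewrite mxvecE.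
apply: continuous_compact; last first.
  apply: (@rV_compact _ _
    (fun k => `[mxvec B 0 k - c, mxvec B 0 k + c]%classic)).
  by move=> k; exact: segment_compact.
apply: continuous_subspaceT => v W /nbhs_ballP[e /= e0 eW].
apply/nbhs_ballP; exists e => //= w [_ vw]; apply: eW.
by split=> // i j; rewrite !mxE; exact: vw.
Qed.

Lemma closed_det1 : closed [set M : 'M[R]_2 | \det M = 1].
Proof.
have -> : [set M : 'M[R]_2 | \det M = 1] =
    (fun M => M 0 0 * M 1 1 - M 0 1 * M 1 0) @^-1` [set 1].
  by rewrite eqEsubset; split=> M /=; rewrite [in \det _](mx2_eta M) mx2_det.
apply: preimage_closed => [M _|]; last first.
  apply: accessible_closed_set1; apply: hausdorff_accessible.
  exact: Rhausdorff.
have c i j := @coord_continuous R 2 2 i j M.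
exact: (cvgB (cvgM (c 0 0) (c 1 1)) (cvgM (c 0 1) (c 1 0))).
Qed.

(** SL_2 is closed in the space of matrices, so it inherits compact
    neighbourhoods from boxes. *)
Lemma SL2_compact_nbhs (B : SL R 2) (V : set (SL R 2)) : nbhs B V ->
  exists K : set (SL R 2), [/\ compact K, nbhs B K & K `<=` V].
Proof.
move=> [_ [[W oW <-] WB] WV].
have /nbhs_ballP[e /= e0 eW] : nbhs (val B) W by exact: open_nbhs_nbhs.
pose K := [set M : 'M[R]_2 |
  forall i j, M i j \in `[val B i j - e / 2, val B i j + e / 2]].
have cK : compact (K `&` [set M : 'M[R]_2 | \det M = 1]).
  by apply: compact_closedI; [exact: compact_mx_box|exact: closed_det1].
exists (val @^-1` (K `&` [set M : 'M[R]_2 | \det M = 1])); split.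
- apply: compact_initial cK _ => M [_ /eqP dM].
  by exists (Sub M dM) => //; rewrite SubK.
- have cv : continuous (val : SL R 2 -> 'M[R]_2) by exact: initial_continuous.
  have : nbhs B (val @^-1` ball (val B) (e / 2)).
    by apply: cv; apply: nbhsx_ballx; rewrite divr_gt0.
  apply: filterS => A [_ /= BA]; split; last by exact/eqP/(valP A).
  move=> i j; have := BA i j; rewrite -ball_normE /= ltr_distl in_itv /=.
  by move=> /andP[? ?]; apply/andP; split; lra.
- move=> A [KA _]; apply: WV; apply: eW; split=> // i j.
  have := KA i j; rewrite in_itv /= => /andP[? ?].
  by rewrite -ball_normE /= ltr_distl; apply/andP; split; lra.
Qed.

Lemma continuous_trace_SL2 : continuous (fun A : SL R 2 => \tr (val A)).
Proof.
have cv : continuous (val : SL R 2 -> 'M[R]_2) by exact: initial_continuous.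
have ct : continuous (fun M : 'M[R]_2 => \tr M).
  have -> : (fun M : 'M[R]_2 => \tr M) = (fun M => M 0 0 + M 1 1).
    by apply/funext => M; rewrite [in LHS](mx2_eta M) mx2_tr.
  move=> M; have c i j := @coord_continuous R 2 2 i j M.
  exact: (cvgD (c 0 0) (c 1 1)).
exact: continuous_compT cv ct.
Qed.

End SL2Topology.

End CoveringsAndMatrices.

(** * Connected coverings of SL_2 *)

Section CoverSL2.
Import Order.TTheory GRing.Theory Num.Theory.
Variables (R : realType) (X : preTopologicalGroupType).
Variable p : {multiplicative X -> SL R 2}.
Hypothesis tX : topological_group X.
Hypothesis cX : connected [set: X].
Hypothesis pcov : covering_map p.

Let pM : {morph p : a b / a * b}. Proof. exact: gmulfM. Qed.

Let psurj (A : SL R 2) : exists a, p a = A.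
Proof. by have [_ /(_ A I)[a _ <-] _] := pcov; exists a. Qed.

Lemma SL2_cover_center_scalar a : group_center X a ->
  val (p a) = 1%:M%R \/ val (p a) = (-1)%:M%R.
Proof.
move=> ca; apply: center_SL2 => A; have [b <-] := psurj A.
by rewrite -!pM ca.
Qed.

(** Near 1 the covering is injective and the trace is positive, which excludes
    -1. *)
Lemma SL2_cover_discrete_scalar : exists U : set X, nbhs 1 U /\
  forall a, U a -> val (p a) = 1%:M%R \/ val (p a) = (-1)%:M%R -> a = 1.
Proof.
have [U [nU Uinj]] := covering_locally_injective pcov 1.
have ct : continuous (fun a => \tr (val (p a)))%R.
  have [cp _ _] := pcov.
  exact: (continuous_compT cp (@continuous_trace_SL2 R)).
have tr1 : (\tr (val (p 1%g)) = 2%:R)%R.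
  by rewrite (morph_mulg1 pM) val_SL1 mxtrace1.
exists (U `&` [set a | 0 < \tr (val (p a))]%R); split.
  apply: filterI => //.
  have tpos : nbhs (\tr (val (p 1%g)))%R [set t : R | 0 < t]%R.
    by apply: open_nbhs_nbhs; split; [exact: open_gt|rewrite /= tr1 ltr0n].
  exact: (ct _ _ tpos).
move=> a [Ua /= ta]; have U1 : U 1 by exact: nbhs_singleton.
case=> pa; last first.
  by move: ta; rewrite pa mxtrace_scalar mulNrn oppr_gt0 ltNge ler0n.
by apply: Uinj => //; apply: val_inj; rewrite (morph_mulg1 pM).
Qed.

(** As p a is central, the commutator of a with any h lies over 1.  It depends
    continuously on h and 1 is isolated in the fibre, so the set of h for which
    it is 1 is both open and closed in the connected group X. *)
Lemma SL2_cover_scalar_center a :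
  val (p a) = 1%:M%R \/ val (p a) = (-1)%:M%R -> group_center X a.
Proof.
move=> pa g.
have pac A : p a * A = A * p a.
  by apply: val_inj; rewrite !val_SLM; case: pa => ->; rewrite scalar_mxC.
pose c h := a^-1 * (h^-1 * (a * h)).
have pc h : p (c h) = 1.
  by rewrite /c !pM !(morph_invg pM) pac mulKg mulVg.
have cc : continuous c.
  have cid : continuous (@id X) by move=> t; exact: cvg_id.
  have ccst (b : X) : continuous (fun _ : X => b) by exact: cst_continuous.
  apply: (continuous_mulg tX (ccst _)).
  apply: (continuous_mulg tX (continuous_invg tX cid)).
  exact: (continuous_mulg tX (ccst a) cid).
have [U [nU U1]] := SL2_cover_discrete_scalar.
have [hX _ _] := tX.
have cE : [set h | c h = 1] = [set: X].
  apply: cX.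
  - by exists 1 => /=; rewrite /c invg1 mul1g mulg1 mulVg.
  - exists [set h | c h = 1]; rewrite ?setTI// openE => h /= ch.
    have : nbhs h (c @^-1` U) by apply: cc; rewrite ch.
    by apply: filterS => k /= Uc; apply: U1 => //; left; rewrite pc val_SL1.
  - exists [set h | c h = 1]; rewrite ?setTI//.
    apply: (@preimage_closed _ _ c [set 1]) => [t _|]; first exact: cc.
    by apply: accessible_closed_set1; exact: hausdorff_accessible.
have : [set h | c h = 1] g by rewrite cE.
move=> /= cg; apply: (mulgI g^-1); apply: (mulgI a^-1).
by rewrite mulKg mulVg.
Qed.

Lemma SL2_cover_compact_nbhs (a : X) : exists K, compact K /\ nbhs a K.
Proof. by apply: covering_compact_nbhs pcov _ a; exact: SL2_compact_nbhs. Qed.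

End CoverSL2.

(** * Normal subgroups of the quotient *)

Section CompactNormal.
Local Open Scope quotient_scope.
Import Order.TTheory GRing.Theory Num.Theory.
Variables (R : realType) (X Y : preTopologicalGroupType).
Variable p : {multiplicative X -> SL R 2}.
Hypotheses (tX : topological_group X) (cX : connected [set: X]).
Hypothesis pcov : covering_map p.
Variables (Z : subgroup X) (H : subgroup Y).
Variables (u : {multiplicative subg Z -> subg H}).
Variables (cZ : (Z : set X) `<=` group_center X).
Variables (cH : (H : set Y) `<=` group_center Y).
Let G := quotient_group (graph_normal u cZ cH).
Local Notation pi := (\pi_G : (X * Y)%type -> G).

Let pM : {morph p : a b / a * b}. Proof. exact: gmulfM. Qed.

(** Squaring makes the trace invariant under the central elements, which p sends
    to 1 and -1, so that it descends to the quotient. *)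
Definition trace_sqr (w : X * Y) : R := (\tr (val (p w.1)) ^+ 2)%R.

Lemma trace_sqr_pi (w : X * Y) : trace_sqr (repr (pi w)) = trace_sqr w.
Proof.
have : pi (repr (pi w)) = pi w by rewrite reprK.
case: w (repr (pi w)) => a b [a' b'] /pi_graph_eq[z [-> _]].
rewrite /trace_sqr /= pM val_SLM.
have /cZ/(SL2_cover_center_scalar pcov) := set_mem (valP z).
by case=> ->; rewrite mul_mx_scalar ?scale1r// scaleN1r linearN sqrrN.
Qed.

Lemma continuous_trace_sqr : continuous (trace_sqr \o repr : G -> R).
Proof.
apply/quotient_continuous.
rewrite (_ : _ \o _ = trace_sqr); last first.
  by apply/funext => w; exact: trace_sqr_pi.
have [cp _ _] := pcov.
have ct : continuous (fun w : X * Y => \tr (val (p w.1)))%R.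
  exact: (continuous_compT (continuous_compT (@continuous_fst X Y) cp)
    (@continuous_trace_SL2 R)).
by move=> w; exact: (cvgM (ct w) (ct w)).
Qed.

(** The elements p a, for (a, b) over K, form a normal subgroup of SL_2.  The
    trace is bounded on it, because its square factors through a continuous
    function on the compact set K. *)
Lemma compact_normal_central (K : subgroup G) :
  normal_subgroup K -> compact (K : set G) ->
  forall a b, (K : set G) (pi (a, b)) -> group_center X a.
Proof.
move=> nK cK a0 b0 Kab0; apply: (SL2_cover_scalar_center tX cX pcov).
have piM : forall w w', pi (w * w') = pi w * pi w' :=
  quotient_piM (graph_normal u cZ cH).
have piV : forall w, pi w^-1 = (pi w)^-1 := quotient_piV (graph_normal u cZ cH).
have [M KM] : exists M : R, forall a b, (K : set G) (pi (a, b)) ->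
    (\tr (val (p a)) ^+ 2 <= M)%R.
  have ct := continuous_trace_sqr.
  have : bounded_set ((trace_sqr \o repr : G -> R) @` K).
    apply: compact_bounded; apply: continuous_compact => //.
    exact: continuous_subspaceT.
  move=> [M [_ HM]]; exists (M + 1)%R => a b Kab.
  have := HM (M + 1)%R; rewrite ltrDl ltr01 => /(_ isT _ (imageP _ Kab)).
  by rewrite /= trace_sqr_pi; apply: le_trans; exact: ler_norm.
pose N := [set A | exists a b, (K : set G) (pi (a, b)) /\ A = p a].
apply: (@bounded_normal_SL2 R N (M + 1)%R); last by exists a0, b0.
  move=> _ g [a [b [Kab ->]]]; have [_ /(_ g I)[h _ <-] _] := pcov.
  exists (h^-1 * (a * h)), (1^-1 * (b * 1)); split; last first.
    by rewrite conjgE !pM (morph_invg pM).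
  have /set_mem := nK (pi (h, 1)) _ (mem_set Kab).
  by rewrite conjgE -piV -(piM (a, b)) -piM.
move=> _ _ [a [b [Kab ->]]] [a' [b' [Kab' ->]]].
have := KM (a * a') (b * b'); rewrite pM => /(_ _).
rewrite ler_norml; set t := (\tr _)%R => tM.
have {}tM : (t ^+ 2 <= M)%R.
  apply: tM; have := group_closedM (subgroupP K) (mem_set Kab) (mem_set Kab').
  by rewrite -(piM (a, b)) => /set_mem.
by move: tM; rewrite expr2 => tM; apply/andP; split; nra.
Qed.

(** The preceding lemma puts K inside the image of 1 * Y.  Being connected, K
    also lies in the image of V * 1 for a small neighbourhood V of 1 in X, and
    these two images meet only in 1. *)
Lemma compact_connected_normal_trivial (K : subgroup G) :
  topological_group Y ->
  zero_dimensional Y ->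
  group_center X `<=` (Z : set X) ->
  normal_subgroup K -> compact (K : set G) -> connected (K : set G) ->
  forall k, (K : set G) k -> k = 1.
Proof.
move=> tY zY Zc nK cK coK k Kk.
have K1Y g : (K : set G) g -> exists b, g = pi (1, b).
  have [[a b] ->] := @pi_surj _ _ (graph_normal u cZ cH) g => Kab.
  have Za : (Z : set X) a by apply: Zc; exact: compact_normal_central Kab.
  pose z : subg Z := Sub a (mem_set Za).
  exists (b * (val (u z))^-1); apply/esym/pi_graph_eq; exists z.
  by rewrite mul1g mulgVK.
have [U [nU U1]] := SL2_cover_discrete_scalar pcov.
have UZ z : U z -> (Z : set X) z -> z = 1.
  by move=> Uz /cZ/(SL2_cover_center_scalar pcov); exact: U1.
have [V [oV V1 VZ]] := small_nbhs tX nU UZ.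
have KV : (K : set G) `<=` pi @` (V `*` [set 1]).
  apply: (small_connected tX tY (u := u) (cZ := cZ) (cH := cH)) => //.
    by apply: set_mem; exact: (subgroupP K).1.
  by move=> g /K1Y[b ->]; exists (1, b).
have [[v b] [/= Vv ->] vk] := KV _ Kk.
have [b' kb'] := K1Y _ Kk.
have : pi (v, 1) = pi (1, b') by rewrite vk.
move=> /pi_graph_eq[z [v1 _]].
have v1' : v = 1.
  apply: VZ => //; rewrite v1 mulKg; exact: set_mem (valP z).
by rewrite -vk v1'.
Qed.

End CompactNormal.

(** In the finer topology the group is connected and locally connected, so every
    element lies in the image of X * 1; and (1, b) is congruent to some (a, 1)
    only if b is a value of u. *)
Lemma virtual_lie_graph_quotient (R : realType)
  (X Y : preTopologicalGroupType)
  (tX : topological_group X) (tY : topological_group Y)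
  (Z : subgroup X) (H : subgroup Y) (u : {multiplicative subg Z -> subg H})
  (cZ : (Z : set X) `<=` group_center X) (cH : (H : set Y) `<=` group_center Y)
  (U : set X) (nU : nbhs (1 : X) U)
  (UZ : forall z, U z -> (Z : set X) z -> z = 1)
  (zY : zero_dimensional Y)
  (L : subgroup (quotient_group (graph_normal u cZ cH))) :
  virtual_lie_group R (subg L) -> (L : set _) = setT -> (H : set Y) = setT.
Proof.
move=> [_ [tau [fine lie conn]]] LT; rewrite -subTset => b _.
pose G := quotient_group (graph_normal u cZ cH).
pose pi := (\pi_G)%qT : (X * Y)%type -> G.
pose T := retopologize tau.
pose f : T -> G := fun t => val (t : subg L).
have fM : {morph f : s t / s * t} by exact: valM.
have cf : continuous f.
  apply/continuousP => A oA; rewrite open_retopologize; apply: fine.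
  by exists A.
have [tT _ _] := lie.
have Lb : pi (1, b) \in (L : set G) by rewrite LT mem_setT.
have [a] := locally_connected_image tX tY nU UZ zY fM tT conn
  (lie_group_locally_connected lie) cf (Sub (pi (1, b)) Lb : subg L).
rewrite /f SubK => /esym/pi_graph_eq[z [_ ->]].
by rewrite mul1g; exact: set_mem (valP (u z)).
Qed.

Theorem proposition4p10 (R : realType)
    (X : preTopologicalGroupType) (p : {multiplicative X -> SL R 2})
    (hX : universal_covering_group R p)
    (x : X) (hx : cyclic_subgroup x = group_center X :> set X)
    (y : Z2adic) (hy : closure (cyclic_subgroup y) = [set: Z2adic])
    (u : {multiplicative subg (cyclic_subgroup x) -> subg (cyclic_subgroup y)})
    (hu : u (cyclic_gen x) = cyclic_gen y) :
  let G : preTopologicalGroupType :=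
    quotient_group
      (graph_normal u (subsetW hx) (@Z2adic_center (cyclic_subgroup y))) in
  [/\ topological_group G,
      connected [set: G],
      locally_compact [set: G] &
      ~ exists K L : subgroup G,
          [/\ normal_subgroup K /\ normal_subgroup L,
              virtual_lie_group R (subg L),
              compact (K : set G) /\ connected (K : set G) &
              [set: G] = [set k * l | k in (K : set G) & l in (L : set G)]]].
Proof.
have [tX scX pcov] := hX.
have tY := topological_group_Z2adic.
have cX : connected [set: X] := simply_connected_connected 1 scX.
have [U [nU U1]] := SL2_cover_discrete_scalar pcov.
have UZ z : U z -> (cyclic_subgroup x : set X) z -> z = 1.
  move=> Uz; rewrite hx => /(SL2_cover_center_scalar pcov); exact: U1.
have clZ : closed (cyclic_subgroup x : set X).
  by rewrite hx; exact: closed_center.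
have zY := zero_dimensional_Z2adic.
move=> G.
have tG : topological_group G.
  apply: topological_group_quotient; first exact: topological_group_prod.
  exact: (closed_graph tX tY nU UZ).
split=> //.
- by apply: connected_graph_quotient => //; exact: cyclic_morphism_surj.
- have [hG _ _] := tG.
  apply: locally_compact_quotient => //; last exact: compact_Z2adic.
  exact: SL2_cover_compact_nbhs pcov.
- move=> [K [L [[nK _] vL [cK coK] KL]]].
  have K1 := compact_connected_normal_trivial tX cX pcov tY zY
    (subsetW (esym hx)) nK cK coK.
  have LT : (L : set G) = setT.
    rewrite -subTset => g; rewrite KL => -[k /K1 -> [l Ll <-]].
    by rewrite mul1g.
  have [b nb] := dense_cyclic_proper hy.
  by apply: nb; rewrite (virtual_lie_graph_quotient tX tY nU UZ zY vL LT).
Qed.
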